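(* Let $T>0$ and let $\zeta:]-T,T[\rightarrow\mathbb{H}$ be a smooth horizontal curve parametrized by arc length in the Heisenberg group. Let $\pi:\mathbb{H}\to\mathbb{R}^2$, $\pi(x,y,z)=(x,y)$. Then for every $t\in\,]-T,T[$, the characteristic deviation $h_\zeta(t)$ of $\zeta$ is equal to the signed Euclidean curvature of the plane curve $\pi\circ\zeta$ at time $t$.
   Context: The Heisenberg group $\mathbb{H}$ is $\mathbb{R}^3$ with coordinates $(x,y,z)$, endowed with the two-dimensional distribution spanned by $X_1=\frac{\partial}{\partial x}-\frac{y}{2}\frac{\partial}{\partial z}$ and $X_2=\frac{\partial}{\partial y}+\frac{x}{2}\frac{\partial}{\partial z}$, with the metric on the distribution for which $(X_1,X_2)$ is an orthonormal frame. A smooth curve is horizontal if it is everywhere tangent to the distribution, and parametrized by arc length if its velocity, expressed in the orthonormal frame $(X_1,X_2)$, has norm $1$ everywhere. For a smooth horizontal curve $\zeta(t)=(x(t),y(t),z(t))$ parametrized by arc length, the characteristic deviation is $h_\zeta(t)=\dot x(t)\ddot y(t)-\dot y(t)\ddot x(t)$. The signed Euclidean curvature at time $t$ of a regular plane curve $(x(t),y(t))$ is $\frac{\dot x(t)\ddot y(t)-\dot y(t)\ddot x(t)}{(\dot x^2(t)+\dot y^2(t))^{3/2}}$. *)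

(* Defs.v *)
From HB Require Import structures.
From mathcomp Require Export all_boot all_order all_algebra.
From mathcomp Require Export all_classical all_reals all_analysis.

Set Implicit Arguments.
Unset Strict Implicit.
Unset Printing Implicit Defensive.

Import Order.TTheory GRing.Theory Num.Theory.
Import numFieldNormedType.Exports.

Local Open Scope classical_set_scope.
Local Open Scope ring_scope.

(* The Heisenberg group is modelled on 'rV[R]_3 with coordinates
   x = p 0 0, y = p 0 1, z = p 0 2; a curve ]-T, T[ -> H is a total function
   R -> 'rV[R]_3 of which only the restriction to `]-T, T[ is constrained.
   That interval being open, the derivatives of all orders at its points
   depend on this restriction only. *)

Definition vec3 (R : realType) (a b c : R) : 'rV[R]_3 :=
  \row_(i < 3) [:: a; b; c]`_i.

Definition X1 (R : realType) (p : 'rV[R]_3) : 'rV[R]_3 :=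
  vec3 1 0 (- (p 0 1 / 2)).

Definition X2 (R : realType) (p : 'rV[R]_3) : 'rV[R]_3 :=
  vec3 0 1 (p 0 0 / 2).

(* The tangent vector at p whose coordinates in the frame (X1, X2) are u. *)
Definition frame_comb (R : realType) (p : 'rV[R]_3) (u : 'rV[R]_2) : 'rV[R]_3 :=
  u 0 0 *: X1 p + u 0 1 *: X2 p.

Definition distribution (R : realType) (p : 'rV[R]_3) : set 'rV[R]_3 :=
  range (frame_comb p).

(* The norm `|u| that MathComp-Analysis puts on 'rV[R]_n is the sup norm. *)
Definition euclidean_norm (R : realType) (n : nat) (u : 'rV[R]_n) : R :=
  Num.sqrt (\sum_(i < n) u 0 i ^+ 2).

Definition smooth_on (R : realType) (n : nat) (A : set R) (c : R -> 'rV[R]_n) :=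
  forall (k : nat) (t : R), A t -> derivable (derive1n k c) t 1.

Definition horizontal_on (R : realType) (A : set R) (c : R -> 'rV[R]_3) :=
  forall t : R, A t -> distribution (c t) (derive1 c t).

Definition arclength_on (R : realType) (A : set R) (c : R -> 'rV[R]_3) :=
  forall t : R, A t ->
    exists2 u : 'rV[R]_2,
      derive1 c t = frame_comb (c t) u & euclidean_norm u = 1.

Definition characteristic_deviation (R : realType) (c : R -> 'rV[R]_3) (t : R) : R :=
  let x := fun s => c s 0 0 in
  let y := fun s => c s 0 1 in
  derive1 x t * derive1n 2 y t - derive1 y t * derive1n 2 x t.

(* Meaningful at times t where the plane curve c is regular. *)
Definition signed_curvature (R : realType) (c : R -> 'rV[R]_2) (t : R) : R :=
  let x := fun s => c s 0 0 in
  let y := fun s => c s 0 1 in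
  (derive1 x t * derive1n 2 y t - derive1 y t * derive1n 2 x t)
    / (derive1 x t ^+ 2 + derive1 y t ^+ 2) `^ (3 / 2).

Definition plane_proj (R : realType) (p : 'rV[R]_3) : 'rV[R]_2 :=
  \row_(i < 2) [:: p 0 0; p 0 1]`_i.

(* Main.v *)
Require Import Defs.

Import Order.TTheory GRing.Theory Num.Theory.
Import numFieldNormedType.Exports.
Local Open Scope classical_set_scope.
Local Open Scope ring_scope.

(* The frame (X1, X2) projects to the standard basis of the plane, so the
   projection of an arc-length horizontal curve has unit Euclidean speed and
   the denominator of its curvature is 1. *)

(** Deviation and curvature share their numerator, because [plane_proj] keeps the coordinates x and
    y. Only the denominator (x'^2 + y'^2)^(3/2) remains, and [arclength_plane_speed] gives x'^2 +
    y'^2 = 1. *)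

Lemma derive1_mx (R : realType) (m n : nat) (M : R -> 'M[R]_(m, n)) (t : R)
    (i : 'I_m) (j : 'I_n) :
  derivable M t 1 -> derive1 (fun s => M s i j) t = derive1 M t i j.
Proof. by move=> dM; rewrite !derive1E derive_mx// mxE. Qed.

Lemma arclength_plane_speed (R : realType) (A : set R) (c : R -> 'rV[R]_3)
    (t : R) :
  arclength_on A c -> A t -> derivable c t 1 ->
  derive1 (fun s => c s 0 0) t ^+ 2 + derive1 (fun s => c s 0 1) t ^+ 2 = 1.
Proof.
move=> arcc At dc; have [u dcE u1] := arcc _ At.
(* The x and y components of [X1] and [X2] are (1, 0) and (0, 1), so x' and y' are exactly the frame
   coordinates in [u]. *)
rewrite !derive1_mx// dcE !mxE /= !(mulr1, mulr0) addr0 add0r.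
move: u1; rewrite /euclidean_norm !big_ord_recl big_ord0 addr0.
rewrite (_ : lift ord0 ord0 = 1); last exact/val_inj.
move=> /(congr1 (@GRing.exp R ^~ 2)).
by rewrite sqr_sqrtr ?expr1n// addr_ge0// sqr_ge0.
Qed.

Theorem proposition5p7 (R : realType) (T : R) (hT : 0 < T)
    (zeta : R -> 'rV[R]_3)
    (zeta_smooth : smooth_on `]-T, T[ zeta)
    (zeta_horizontal : horizontal_on `]-T, T[ zeta)
    (zeta_arclength : arclength_on `]-T, T[ zeta) :
  forall t : R, t \in `]-T, T[ ->
    characteristic_deviation zeta t
      = signed_curvature (@plane_proj R \o zeta) t.
Proof.
move=> t tT.
rewrite /signed_curvature /characteristic_deviation /=.
have -> : (fun s => plane_proj (zeta s) 0 0) = fun s => zeta s 0 0.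
  by apply/funext => s; rewrite mxE.
have -> : (fun s => plane_proj (zeta s) 0 1) = fun s => zeta s 0 1.
  by apply/funext => s; rewrite mxE.
(* Smoothness at order 0 is derivability of [zeta] itself. *)
rewrite (arclength_plane_speed _ _ _ _ zeta_arclength tT); last exact: (zeta_smooth 0).
by rewrite powR1 divr1.
Qed.
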